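(* Fix a positive integer $k\geq 2$ and real numbers $\alpha,\beta\in(0,1)$ with $\alpha+\beta\geq (k+2)/k$. Let $n$ be a positive integer, sufficiently large in terms of $k,\alpha,\beta$, let $\ell\geq 2$ be an integer with $k^2\ell\leq n/3$, and let $m=\binom{n}{k}$. Then one can find $\lfloor m/\ell\rfloor$ $(k,\ell)$-parpartitions of $[n]$ such that (1) no $k$-element subset of $[n]$ appears in two of these parpartitions, and (2) no two distinct of these parpartitions $P_1,P_2$ are $(\alpha,\beta)$-close.
   Context: A $(k,\ell)$-parpartition (partial partition) of $[n]=\{1,\dots,n\}$ is a family of $\ell$ pairwise disjoint $k$-element subsets of $[n]$ (so $k\ell\leq n$; their union may be a proper subset of $[n]$). Two parpartitions $P_1,P_2$ are $(\alpha,\beta)$-close if there exist sets $A_1\neq B_1$ in $P_1$ and $A_2\neq B_2$ in $P_2$ with $|A_1\cap A_2|>\alpha k$ and $|B_1\cap B_2|>\beta k$. *)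

(* Defs.v *)
From HB Require Import structures.
From mathcomp Require Import all_boot all_order all_algebra.
From mathcomp Require Import reals.
Set Implicit Arguments. Unset Strict Implicit. Unset Printing Implicit Defensive.
Import Order.TTheory GRing.Theory Num.Theory.

(* [n] = {1,...,n} is represented by 'I_n = {0,...,n-1}. *)

Definition parpartition (n k l : nat) (P : {set {set 'I_n}}) : Prop :=
  [/\ #|P| = l,
      (forall A, A \in P -> #|A| = k) &
      (forall A B, A \in P -> B \in P -> A != B -> [disjoint A & B])].

Definition ab_close (R : realType) (n k : nat) (alpha beta : R)
    (P1 P2 : {set {set 'I_n}}) : Prop :=
  exists A1 B1 A2 B2 : {set 'I_n},
    [/\ A1 \in P1, B1 \in P1, A1 != B1, A2 \in P2 & B2 \in P2] /\
    [/\ A2 != B2,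
        (alpha * k%:R < (#|A1 :&: A2|)%:R)%R &
        (beta * k%:R < (#|B1 :&: B2|)%:R)%R].

(* Main.v *)
(** Grow a partial assignment of the k-sets to the [m %/ l] classes one set at a
    time.  Call two k-sets in conflict if they intersect, or if putting them in
    one class would make it close to some existing class.  A k-set is in
    conflict with at most [m / (3 l) + O(l n^(k-3))] others, since [k^2 l <= n / 3]
    and the two large intersections have total size at least [k + 3].  Given an
    unassigned set x and a class P with fewer than l members, fewer than m of the
    sets y are in conflict with a member of P or share a class with a set in
    conflict with x.  For any other y, put y into P and, if y was already in a
    class, put x in its place there. *)

Require Import Defs.
From HB Require Import structures.
From mathcomp Require Import all_boot all_order all_algebra.
From mathcomp Require Import reals archimedean zify.
Import Order.TTheory GRing.Theory Num.Theory.

(** * A union bound *)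

Lemma card_bigcup_le (I T : finType) (A : {set I}) (F : I -> {set T}) b :
  (forall i, i \in A -> #|F i| <= b) -> #|\bigcup_(i in A) F i| <= #|A| * b.
Proof.
move=> Fb; apply: (@leq_trans (\sum_(i in A) #|F i|)).
  elim/big_rec2: _ => [|i m B _ IH]; first by rewrite cards0.
  by apply: leq_trans (leq_card_setU _ _) _; rewrite leq_add2l.
by rewrite -sum_nat_const leq_sum.
Qed.

(** * Partial assignments to classes, and conflicts *)

Section Swapping.

(** In the application [T] is the type of k-sets, [meet] means intersecting, and [ra], [rb] mean
    sharing more than alpha k, respectively beta k, points. *)
Variables (T : finType) (meet ra rb : rel T) (M l D da db : nat).

Hypothesis meet_refl : reflexive meet.
Hypothesis meet_sym : symmetric meet.
Hypothesis ra_sym : symmetric ra.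
Hypothesis rb_sym : symmetric rb.
Hypothesis ra_meet : forall x y, ra x y -> meet x y.
Hypothesis rb_meet : forall x y, rb x y -> meet x y.
Hypothesis meet_deg : forall x, #|[set y | meet x y]| <= D.
Hypothesis ra_deg : forall x, #|[set y | ra x y]| <= da.
Hypothesis rb_deg : forall x, #|[set y | rb x y]| <= db.

Definition cclass (c : T -> option 'I_M) i := [set x | c x == Some i].

Definition placed (c : T -> option 'I_M) := [set x | c x != None].

Record admissible (c : T -> option 'I_M) : Prop := Admissible {
  adm_size : forall i, #|cclass c i| <= l;
  adm_disj : forall i x y, c x = Some i -> c y = Some i -> x != y -> ~~ meet x y;
  adm_far : forall i j x y z w, i != j -> c x = Some i -> c y = Some i ->
    c z = Some j -> c w = Some j -> x != y -> z != w -> ra x z -> rb y w -> False }.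

(* Some class contains z, w (possibly equal) that would witness closeness to a
   class containing both x and y. *)
Definition close_thru (c : T -> option 'I_M) x y :=
  [exists z, exists w, [&& c z != None, c w == c z &
     (ra x z && rb y w) || (rb x z && ra y w)]].

Definition conflict c x y := meet x y || close_thru c x y.

Lemma conflict_sym c : symmetric (conflict c).
Proof.
suff H x y : close_thru c x y -> close_thru c y x.
  by move=> x y; rewrite /conflict meet_sym; congr (_ || _); apply/idP/idP; exact: H.
case/existsP=> z /existsP[w /and3P[cz /eqP cw zw]].
apply/existsP; exists w; apply/existsP; exists z.
by rewrite cw cz eqxx /= orbC andbC [X in _ || X]andbC.
Qed.

Lemma same_color_le c z : admissible c -> c z != None ->
  #|[set w | c w == c z]| <= l.
Proof. by move=> /adm_size cl; case: (c z) => // i _; exact: cl. Qed.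

(** Choose [z] among the [dr] neighbours of [x], then [w] among the at most [l] members of its
    class, then a neighbour of [w] in [ds] ways. *)
Lemma card_thru_le c (r s : rel T) dr ds x : admissible c ->
  (forall x, #|[set y | r x y]| <= dr) -> (forall x, #|[set y | s x y]| <= ds) ->
  #|\bigcup_(z in [set z | r x z & c z != None])
      \bigcup_(w in [set w | c w == c z]) [set y | s w y]| <= dr * (l * ds).
Proof.
move=> adm rd sd.
apply: leq_trans (_ : #|[set z | r x z & c z != None]| * (l * ds) <= _); last first.
  rewrite leq_mul2r (leq_trans _ (rd x)) ?orbT // subset_leq_card //.
  by apply/subsetP=> z; rewrite !inE => /andP[].
apply: card_bigcup_le => z; rewrite inE => /andP[_ cz].
apply: leq_trans (_ : #|[set w | c w == c z]| * ds <= _).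
  by apply: card_bigcup_le => w _; exact: sd.
by rewrite leq_mul2r same_color_le ?orbT.
Qed.

(** [meet] contributes [D], and each of the two orders of [ra] and [rb] in [close_thru] contributes
    [l * da * db]. *)
Lemma conflict_deg c x : admissible c ->
  #|[set y | conflict c x y]| <= D + 2 * l * da * db.
Proof.
move=> adm; have H1 := card_thru_le c ra rb da db x adm ra_deg rb_deg.
have H2 := card_thru_le c rb ra db da x adm rb_deg ra_deg.
set U1 := \bigcup_(_ in _) _ in H1; set U2 := \bigcup_(_ in _) _ in H2.
apply: leq_trans (_ : #|[set y | meet x y] :|: (U1 :|: U2)| <= _); last first.
  apply: leq_trans (leq_card_setU _ _) _; apply: leq_add; first exact: meet_deg.
  apply: leq_trans (leq_card_setU _ _) _; nia.
apply: subset_leq_card; apply/subsetP=> y; rewrite !inE.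
case/orP=> [->//|/existsP[z /existsP[w /and3P[cz cw zw]]]].
by case/orP: zw => /andP[xz yw]; apply/or3P; [apply: Or32|apply: Or33];
  apply/bigcupP; exists z; rewrite ?inE ?xz //; apply/bigcupP; exists w;
  rewrite ?inE // 1?rb_sym 1?ra_sym // rb_sym.
Qed.

(** * The swap and its admissibility *)

Definition swap (c : T -> option 'I_M) x i y z :=
  if z == y then Some i else if z == x then c y else c z.

Section Swap.

Variables (c : T -> option 'I_M) (x y : T) (i : 'I_M).
Hypothesis adm : admissible c.
Hypothesis cx : c x = None.
Hypothesis il : #|cclass c i| < l.
Hypothesis y_free : forall p, c p = Some i -> ~~ conflict c p y.
(** The instance [z = y] is included: if [y] was assigned, it is not in conflict with [x] itself. *)
Hypothesis x_free : forall z, c y != None -> c z = c y -> ~~ conflict c x z.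

(** By reflexivity of [meet], [y] is in conflict with itself, so [y_free] keeps it out of class
    [i]. *)
Lemma swap_cyi : c y != Some i.
Proof. by apply/eqP=> /y_free; rewrite /conflict meet_refl. Qed.

(** The new companions of [y] are old members of class [i], covered by [y_free]; those of [x] are
    old companions of [y], covered by [x_free]. By [swap_cyi], [x] and [y] never end up in one
    class. *)
Lemma swap_conflict j u v : swap c x i y u = Some j -> swap c x i y v = Some j ->
  u != v -> u \in [:: x; y] -> ~~ conflict c u v.
Proof.
have cyi := swap_cyi; rewrite /swap !inE => cu cv; rewrite eq_sym => vu un.
case: (u =P y) cu un vu => [->|uy].
  move=> [ij] _ vy; move: cv; rewrite (negPf vy) -ij.
  case: (v =P x) => [_ cy|_ cv]; first by rewrite cy eqxx in cyi.
  by rewrite conflict_sym y_free.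
case: (u =P x) => // -> cy _ vx; move: cv; rewrite (negPf vx).
case: (v =P y) => [_ [ij]|vy cv]; first by rewrite cy ij eqxx in cyi.
by rewrite x_free // ?cy // cv.
Qed.

Lemma swap_old u : u \notin [:: x; y] -> swap c x i y u = c u.
Proof. by rewrite !inE negb_or /swap => /andP[/negPf-> /negPf->]. Qed.

(** Class [i] had room for [y]; the former class of [y], if any, exchanges [y] for [x]; no other
    class gains a member. *)
Lemma swap_size j : #|cclass (swap c x i y) j| <= l.
Proof.
have [->|ji] := eqVneq j i.
  apply: leq_trans (_ : #|y |: cclass c i| <= _); last first.
    by apply: leq_trans (leq_card_setU _ _) _; rewrite cards1.
  apply: subset_leq_card; apply/subsetP=> z; rewrite !inE /swap.
  case: (z =P y) => //= _; case: (z =P x) => //= _.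
  by rewrite (negPf swap_cyi).
have [cy|cy] := eqVneq (c y) (Some j).
  have yj : y \in cclass c j by rewrite inE cy.
  apply: leq_trans (_ : #|x |: (cclass c j :\ y)| <= _); last first.
    apply: leq_trans (leq_card_setU _ _) _; rewrite cards1.
    by have := cardsD1 y (cclass c j); rewrite yj => <-; exact: adm_size.
  apply: subset_leq_card; apply/subsetP=> z; rewrite !inE /swap.
  case: (z =P y) => //= _; first by case/eqP=> ij; rewrite ij eqxx in ji.
  by case: (z =P x).
apply: leq_trans (adm_size _ adm j); apply: subset_leq_card; apply/subsetP=> z.
rewrite !inE /swap; case: (z =P y) => //= _; first by case/eqP=> ij; rewrite ij eqxx in ji.
by case: (z =P x) => //= _; rewrite (negPf cy).
Qed.

Lemma swap_disj j u v : swap c x i y u = Some j -> swap c x i y v = Some j ->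
  u != v -> ~~ meet u v.
Proof.
move=> cu cv uv.
have [un|uo] := boolP (u \in [:: x; y]).
  by have := swap_conflict _ _ _ cu cv uv un; rewrite negb_or => /andP[].
have [vn|vo] := boolP (v \in [:: x; y]).
  rewrite eq_sym in uv.
  have := swap_conflict _ _ _ cv cu uv vn.
  by rewrite negb_or meet_sym => /andP[].
by move: cu cv; rewrite !swap_old // => cu cv; exact: (adm_disj _ adm) cu cv uv.
Qed.

(** The unmoved [z] and [w] already shared a class under [c], so they would witness
    [close_thru c u v], against [swap_conflict]. *)
Lemma swap_no_thru j j' u v z w : swap c x i y u = Some j ->
  swap c x i y v = Some j -> swap c x i y z = Some j' -> swap c x i y w = Some j' ->
  u != v -> u \in [:: x; y] -> z \notin [:: x; y] -> w \notin [:: x; y] ->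
  (ra u z && rb v w) || (rb u z && ra v w) -> False.
Proof.
move=> cu cv cz cw uv un zo wo H.
have := swap_conflict _ _ _ cu cv uv un; rewrite negb_or => /andP[_ /existsP[]].
exists z; apply/existsP; exists w.
by move: cz cw; rewrite !swap_old // => -> ->; rewrite eqxx.
Qed.

(* If z = x this is the choice of y; otherwise w = x, so x replaced y in class j
   and z is a former companion of y. *)
Lemma swap_no_cross j z w : j != i ->
  swap c x i y z = Some j -> swap c x i y w = Some j ->
  (z == x) || (w == x) -> ~~ meet y z.
Proof.
move=> ji cz cw zwx.
have yj t : swap c x i y t = Some j -> t != y.
  by move=> ct; apply: contraNneq ji => ty; move: ct; rewrite /swap ty eqxx => -[->].
have cy : c y = Some j.
  have cx' : swap c x i y x = Some j.
    by case/orP: (zwx) => /eqP e; [move: cz|move: cw]; rewrite e.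
  by move: (cx'); rewrite /swap (negPf (yj _ cx')) eqxx.
have := yj _ cz; rewrite eq_sym => yz.
case: (z =P x) zwx => [zx _|/eqP zx _].
  have := x_free y; rewrite cy => /(_ isT erefl).
  by rewrite /conflict meet_sym zx negb_or => /andP[].
move: cz; rewrite swap_old ?inE ?negb_or ?zx 1?eq_sym // => cz.
exact: (adm_disj _ adm) cy cz yz.
Qed.

Lemma swap_class_y j : swap c x i y y = Some j -> j = i.
Proof. by rewrite /swap eqxx => -[]. Qed.

(** Split by which of the pairs [u, v] and [z, w] contain [x] or [y]. If neither does, [c] was
    already not admissible; if exactly one does, [swap_no_thru] applies. *)
Lemma swap_far j j' u v z w : j != j' -> swap c x i y u = Some j ->
  swap c x i y v = Some j -> swap c x i y z = Some j' -> swap c x i y w = Some j' ->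
  u != v -> z != w -> ra u z -> rb v w -> False.
Proof.
move=> jj cu cv cz cw uv zw uz vw.
have vu : v != u by rewrite eq_sym.
have wz : w != z by rewrite eq_sym.
have zu : ra z u by rewrite ra_sym.
have wv : rb w v by rewrite rb_sym.
have [old1|new1] := boolP ((u \notin [:: x; y]) && (v \notin [:: x; y])).
  have /andP[uo vo] := old1.
  have [old2|] := boolP ((z \notin [:: x; y]) && (w \notin [:: x; y])).
    move: cu cv cz cw; have /andP[zo wo] := old2; rewrite !swap_old // => cu cv cz cw.
    exact: (adm_far _ adm) jj cu cv cz cw uv zw uz vw.
  rewrite negb_and !negbK => /orP[zn|wn].
    by apply: (swap_no_thru _ _ z w u v cz cw cu cv) => //; rewrite zu wv.
  by apply: (swap_no_thru _ _ w z v u cw cz cv cu) => //; rewrite zu wv orbT.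
have [old2|new2] := boolP ((z \notin [:: x; y]) && (w \notin [:: x; y])).
  have /andP[zo wo] := old2.
  move: new1; rewrite negb_and !negbK => /orP[un|vn].
    by apply: (swap_no_thru _ _ u v z w cu cv cz cw) => //; rewrite uz vw.
  by apply: (swap_no_thru _ _ v u w z cv cu cw cz) => //; rewrite uz vw orbT.
(* Now both pairs contain a moved set. If [y] lies in one, its class is [i], the other pair contains
   [x], and [swap_no_cross] forbids [y] to meet that pair. Otherwise [x] lies in both pairs, hence
   in two classes. *)
have moved p q : ~~ ((p \notin [:: x; y]) && (q \notin [:: x; y])) ->
    p != y -> q != y -> (p == x) || (q == x).
  by rewrite negb_and !negbK !inE => pq /negPf py /negPf qy; rewrite py qy !orbF in pq.
have in_i k t : swap c x i y t = Some k -> t = y -> k = i.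
  by move=> ct ty; move: ct; rewrite ty; exact: swap_class_y.
have in_x k p q : swap c x i y p = Some k -> swap c x i y q = Some k ->
    (p == x) || (q == x) -> swap c x i y x = Some k.
  by move=> cp cq /orP[] /eqP e; [move: cp|move: cq]; rewrite e.
have not_y k k' p t : k != k' -> swap c x i y p = Some k -> p = y ->
    swap c x i y t = Some k' -> t != y.
  move=> kk cp ey ct; apply: contraNneq kk => ty.
  by rewrite (in_i _ _ cp ey) (in_i _ _ ct ty).
have j'j : j' != j by rewrite eq_sym.
have [uy|uy] := eqVneq u y.
  have zwx : (z == x) || (w == x) by apply: moved new2 _ _; apply: not_y jj cu uy _.
  have j'i : j' != i by rewrite -(in_i _ _ cu uy).
  by have := swap_no_cross _ _ _ j'i cz cw zwx; rewrite -uy ra_meet.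
have [vy|vy] := eqVneq v y.
  have wzx : (w == x) || (z == x).
    by rewrite orbC; apply: moved new2 _ _; apply: not_y jj cv vy _.
  have j'i : j' != i by rewrite -(in_i _ _ cv vy).
  by have := swap_no_cross _ _ _ j'i cw cz wzx; rewrite -vy rb_meet.
have uvx := moved _ _ new1 uy vy.
have [zy|zy] := eqVneq z y.
  have ji : j != i by rewrite -(in_i _ _ cz zy).
  by have := swap_no_cross _ _ _ ji cu cv uvx; rewrite -zy ra_meet.
have [wy|wy] := eqVneq w y.
  have ji : j != i by rewrite -(in_i _ _ cw wy).
  have vux : (v == x) || (u == x) by rewrite orbC.
  by have := swap_no_cross _ _ _ ji cv cu vux; rewrite -wy rb_meet.
have zwx := moved _ _ new2 zy wy.
by move: jj; have := in_x _ _ _ cu cv uvx; rewrite (in_x _ _ _ cz cw zwx) => -[->]; rewrite eqxx.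
Qed.

Lemma swap_admissible : admissible (swap c x i y).
Proof. by split; [exact: swap_size|exact: swap_disj|exact: swap_far]. Qed.

(** The newly placed set is [y] if it was unassigned, and [x] otherwise. *)
Lemma card_placed_swap : #|placed (swap c x i y)| = #|placed c|.+1.
Proof.
have [cy|cy] := eqVneq (c y) None.
  suff -> : placed (swap c x i y) = y |: placed c by rewrite cardsU1 inE cy.
  apply/setP=> z; rewrite !inE /swap; case: (z =P y) => //= _.
  by case: (z =P x) => // ->; rewrite cy cx.
suff -> : placed (swap c x i y) = x |: placed c by rewrite cardsU1 inE cx.
apply/setP=> z; rewrite !inE /swap; case: (z =P y) => [->|] //=.
  by rewrite cy orbT.
by case: (z =P x).
Qed.

End Swap.

(** * Growing the assignment until all classes are full *)

Lemma card_placed c : #|placed c| = \sum_i #|cclass c i|.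
Proof.
rewrite (eq_bigr (fun i => \sum_x (c x == Some i))); last first.
  by move=> i _; rewrite -sum1_card big_mkcond /=; apply: eq_bigr => x _; rewrite inE; case: eqP.
rewrite exchange_big /= -sum1_card big_mkcond /=; apply: eq_bigr => x _.
rewrite inE; case: (c x) => [i|]; last by rewrite big1.
by rewrite (bigD1 i) //= eqxx big1 // => j ji; rewrite (inj_eq Some_inj) eq_sym (negPf ji).
Qed.

Hypothesis l_gt0 : 0 < l.
Hypothesis deg_small : 2 * l * (D + 2 * l * da * db) <= #|T|.
Hypothesis Ml : M * l <= #|T|.

Lemma exists_swap c x i : admissible c -> c x = None -> #|cclass c i| < l ->
  exists y, (forall p, c p = Some i -> ~~ conflict c p y) /\
    (forall z, c y != None -> c z = c y -> ~~ conflict c x z).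
Proof.
move=> adm cx il; have small := deg_small; set K := D + _ in small.
(* Positivity is what makes the final count strict: [x] meets itself. *)
have K_gt0 : 0 < K.
  rewrite addn_gt0; apply/orP; left; apply: leq_trans (meet_deg x).
  by apply/card_gt0P; exists x; rewrite inE.
(* [W1] and [W2] collect the choices of [y] that violate the first and the second requirement. *)
pose W1 := \bigcup_(p in cclass c i) [set y | conflict c p y].
pose W2 := \bigcup_(z in [set z | conflict c x z])
  (if c z is Some _ then [set y | c y == c z] else set0).
have W1K : #|W1| <= l.-1 * K.
  apply: leq_trans (_ : #|cclass c i| * K <= _).
    by apply: card_bigcup_le => p _; exact: conflict_deg.
  by rewrite leq_mul2r; apply/orP; right; rewrite -ltnS prednK.
have W2K : #|W2| <= K * l.
  apply: leq_trans (_ : #|[set z | conflict c x z]| * l <= _).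
    apply: card_bigcup_le => z _; case cz : (c z) => [j|]; last by rewrite cards0.
    by rewrite -cz same_color_le ?cz.
  by rewrite leq_mul2r conflict_deg ?orbT.
have /subsetPn[y _] : ~~ ([set: T] \subset W1 :|: W2).
  apply: contraL small => /subset_leq_card; rewrite cardsT -ltnNge => TW.
  (* Class [i] is not full, so [W1] costs only [l.-1] neighbourhoods, leaving a total below
     [2 * l * K]. *)
  have lK : l.-1 * K + K * l < 2 * l * K.
    rewrite -{2 3}(prednK l_gt0); move: l.-1 (K) K_gt0 => m N; nia.
  apply: leq_ltn_trans TW _; apply: leq_ltn_trans (leq_card_setU _ _) _.
  exact: leq_ltn_trans (leq_add W1K W2K) lK.
rewrite inE negb_or => /andP[yW1 yW2]; exists y; split=> [p cp|z cy cz].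
  by apply: contra yW1 => py; apply/bigcupP; exists p; rewrite inE ?cp.
apply: contra yW2 => xz; apply/bigcupP; exists z; rewrite ?inE //.
by move: cy; rewrite cz; case E: (c y) => [j|//] _; rewrite inE E.
Qed.

Lemma exists_admissible t : t <= M * l ->
  exists c : T -> option 'I_M, admissible c /\ #|placed c| = t.
Proof.
elim: t => [_|t IH tM].
  exists (fun _ => None); split; last by apply/eqP; rewrite cards_eq0; apply/eqP/setP=> x; rewrite !inE.
  by split=> // i; rewrite (_ : cclass _ i = set0) ?cards0 //; apply/setP=> x; rewrite !inE.
have [c [adm ct]] := IH (ltnW tM).
(* Fewer than [M * l] sets are placed, which leaves both an unassigned set and a class with room. *)
have [x cx] : exists x, c x = None.
  have /subsetPn[x _] : ~~ ([set: T] \subset placed c).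
    by apply: contraL (leq_trans tM Ml) => /subset_leq_card; rewrite cardsT ct -leqNgt.
  by rewrite inE negbK => /eqP; exists x.
have [i il] : exists i, #|cclass c i| < l.
  apply/existsP; apply: contraLR tM; rewrite negb_exists => /forallP full.
  rewrite -leqNgt -ct card_placed -{1}(card_ord M) -sum_nat_const.
  by apply: leq_sum => i _; rewrite leqNgt.
have [y [y_free x_free]] := exists_swap _ _ _ adm cx il.
exists (swap c x i y); split; first exact: swap_admissible.
by rewrite card_placed_swap ?ct.
Qed.

(** With [M * l] sets placed in [M] classes of size at most [l], equality holds in each class. *)
Lemma exists_full_admissible :
  exists c : T -> option 'I_M, admissible c /\ forall i, #|cclass c i| = l.
Proof.
have [c [adm ct]] := exists_admissible _ (leqnn _); exists c; split=> // i.
have le j : #|cclass c j| <= l ?= iff (#|cclass c j| == l).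
  by split=> //; exact: adm_size.
have [_] := leqif_sum (fun j (_ : true) => le j).
rewrite -card_placed ct sum_nat_const card_ord eqxx => /esym/forallP/(_ i).
by move/eqP.
Qed.

End Swapping.

(** * Counting k-sets with large intersection *)

(** Removing [S] maps these sets injectively to subsets of its complement. Only an upper bound is
    claimed, since truncated subtraction gives 1 on the right when [S] has more than [k]
    elements. *)
Lemma card_supersets n k (S : {set 'I_n}) :
  #|[set C : {set 'I_n} | S \subset C & #|C| == k]| <= 'C(n - #|S|, k - #|S|).
Proof.
have -> : n - #|S| = #|~: S| by rewrite [in RHS]cardsCs setCK card_ord.
rewrite -cards_draws.
rewrite -(card_in_imset (f := fun C => C :\: S)).
  apply: subset_leq_card; apply/subsetP=> _ /imsetP[C + ->]; rewrite !inE => /andP[SC /eqP Ck].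
  apply/andP; split; first by rewrite setDE subsetIr.
  by rewrite cardsD (setIidPr SC) Ck.
move=> C C'; rewrite !inE => /andP[SC _] /andP[SC' _] CC'.
by rewrite -(setID C S) -(setID C' S) CC' (setIidPr SC) (setIidPr SC').
Qed.

Lemma card_large_inter n k a (A : {set 'I_n}) : #|A| = k ->
  #|[set C : {set 'I_n} | (#|C| == k) && (a <= #|A :&: C|)]| <= 'C(k, a) * 'C(n - a, k - a).
Proof.
move=> Ak; rewrite -[X in 'C(X, a) * _]Ak -cards_draws.
apply: leq_trans (_ : #|\bigcup_(S in [set S : {set 'I_n} | S \subset A & #|S| == a])
    [set C : {set 'I_n} | S \subset C & #|C| == k]| <= _); last first.
  apply: card_bigcup_le => S; rewrite inE => /andP[_ /eqP <-].
  exact: card_supersets.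
apply: subset_leq_card; apply/subsetP=> C; rewrite inE => /andP[Ck].
(* The bound on the intersection makes its number of [a]-subsets positive; any such subset serves as
   [S]. *)
rewrite -bin_gt0 -cards_draws => /card_gt0P[S]; rewrite inE subsetI => /andP[/andP[SA SC] Sa].
by apply/bigcupP; exists S; rewrite inE ?SA ?SC.
Qed.

Lemma bin_leq_exp n m : 'C(n, m) <= n ^ m.
Proof.
apply: leq_trans (_ : n ^_ m <= _).
  by rewrite -bin_ffact leq_pmulr // fact_gt0.
by rewrite ffact_prod -[X in _ <= n ^ X](card_ord m) -prod_nat_const leq_prod // => i _; exact: leq_subr.
Qed.

(** Each factor [n - i] of the falling factorial is at least half of [n]. *)
Lemma exp_leq_bin n k : 2 * k <= n -> n ^ k <= 2 ^ k * (k`! * 'C(n, k)).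
Proof.
move=> kn; rewrite [k`! * _]mulnC bin_ffact ffact_prod -[X in n ^ X <= _](card_ord k) -[X in 2 ^ X * _](card_ord k).
rewrite -!prod_nat_const -big_split /=; apply: leq_prod => i _.
by have := ltn_ord i; lia.
Qed.

(** The [meet] term takes at most two thirds of ['C(n, k)] and the closeness term at most one third;
    hence the factors 3 and 12 = 3 * 4 below. *)
Lemma inter_degree_small n k l a b : a <= k -> b <= k -> k + 3 <= a + b ->
  0 < n -> 2 * k <= n -> 12 * (2 ^ k * k`! * ('C(k, a) * 'C(k, b))) <= n ->
  3 * (k ^ 2 * l) <= n ->
  2 * l * ('C(k, 1) * 'C(n - 1, k - 1) +
    2 * l * ('C(k, a) * 'C(n - a, k - a)) * ('C(k, b) * 'C(n - b, k - b))) <= 'C(n, k).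
Proof.
move=> ak bk abk n0 kn nbig kl.
have k0 : 0 < k by lia.
have meet_le : 3 * l * ('C(k, 1) * 'C(n - 1, k - 1)) <= 'C(n, k).
  rewrite -(leq_pmul2l n0) bin1 !subn1.
  have := mul_bin_diag n k.-1; rewrite prednK // => E.
  have -> : n * (3 * l * (k * 'C(n.-1, k.-1))) = 3 * (k ^ 2 * l) * 'C(n, k).
    transitivity (3 * l * k * (n * 'C(n.-1, k.-1))); first by lia.
    by rewrite E; lia.
  by rewrite leq_mul2r kl orbT.
have close_le : 12 * (l * l) * ('C(k, a) * 'C(k, b)) *
    ('C(n - a, k - a) * 'C(n - b, k - b)) <= 'C(n, k).
  have ln : l <= n by nia.
  have pos : 0 < 2 ^ k * k`! by rewrite muln_gt0 expn_gt0 fact_gt0.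
  (* The exponents add up to [2 * k - (a + b)], at most [k - 3]. Together with [l <= n] this makes
     the closeness term of order [n ^ (k - 1)], one power of [n] below ['C(n, k)]. *)
  have CC : 'C(n - a, k - a) * 'C(n - b, k - b) <= n ^ (k - 3).
    apply: leq_trans (_ : n ^ (k - a) * n ^ (k - b) <= _).
      by apply: leq_mul; apply: leq_trans (bin_leq_exp _ _) _;
        case: (k - _) => [|m]; rewrite ?expn0 // leq_exp2r // leq_subr.
    by rewrite -expnD leq_pexp2l //; lia.
  rewrite -(leq_pmul2l pos); apply: leq_trans (_ : n ^ k <= _); last first.
    by rewrite -mulnA exp_leq_bin.
  apply: leq_trans (_ : 12 * (2 ^ k * k`! * ('C(k, a) * 'C(k, b))) * (n * n * n ^ (k - 3)) <= _).
    have : l * l * ('C(n - a, k - a) * 'C(n - b, k - b)) <= n * n * n ^ (k - 3).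
      by rewrite !leq_mul.
    move: (_ * 'C(n - b, _)) (n * n * _) (2 ^ k * _) (_ * 'C(k, b)) => u v p q uv.
    rewrite (_ : p * _ = 12 * (p * q) * (l * l * u)); last by lia.
    by rewrite leq_mul2l uv orbT.
  have -> : n ^ k = n * (n * n * n ^ (k - 3)).
    by rewrite -[in LHS](subnKC (_ : 3 <= k)) ?expnD ?mulnA //; lia.
  by rewrite leq_mul2r nbig orbT.
move: meet_le close_le; move: (_ * 'C(n - 1, _)) ('C(k, a)) ('C(k, b)) => x p q.
by move: 'C(n - a, _) 'C(n - b, _) 'C(n, k) => u v m; nia.
Qed.

(** * The k-sets as a finite type *)

Section KSets.

Variables n k : nat.

Definition kset := {A : {set 'I_n} | #|A| == k}.

Definition inter_ge a (A C : kset) := a <= #|val A :&: val C|.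

Lemma inter_ge_sym a : symmetric (inter_ge a).
Proof. by move=> A C; rewrite /inter_ge setIC. Qed.

Lemma inter_ge_deg a A : #|[set C | inter_ge a A C]| <= 'C(k, a) * 'C(n - a, k - a).
Proof.
apply: leq_trans (card_large_inter _ _ a (val A) (eqP (valP A))).
rewrite -(card_imset _ val_inj) subset_leq_card //.
apply/subsetP=> _ /imsetP[C + ->]; rewrite !inE => AC.
by rewrite (valP C).
Qed.

Lemma card_kset : #|{: kset}| = 'C(n, k).
Proof.
rewrite card_sig -[in RHS](card_ord n) -cardsT -cards_draws cardsE /=.
by apply: eq_card => A; rewrite !inE unfold_in subsetT.
Qed.

End KSets.

(** * Integer thresholds and the theorem *)

Lemma truncS_leq (R : realType) (x : R) (j : nat) :
  (0 <= x)%R -> (x < j%:R)%R -> (Num.truncn x).+1 <= j.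
Proof.
move=> /truncn_itv /andP[tx _] xj.
by rewrite -(ltr_nat R); exact: le_lt_trans tx xj.
Qed.

Theorem theorem1p2 (R : realType) (k : nat) (alpha beta : R) :
  (2 <= k)%N ->
  (0 < alpha < 1)%R -> (0 < beta < 1)%R ->
  ((k.+2)%:R / k%:R <= alpha + beta)%R ->
  exists N0 : nat, forall n l : nat,
    (N0 <= n)%N -> (2 <= l)%N -> (3 * (k ^ 2 * l) <= n)%N ->
    exists F : 'I_('C(n, k) %/ l) -> {set {set 'I_n}},
      [/\ (forall i, parpartition k l (F i)),
          (forall i j, i != j -> forall A, A \in F i -> A \notin F j) &
          (forall i j, i != j -> ~ ab_close k alpha beta (F i) (F j))].
Proof.
move=> k2 /andP[a0 a1] /andP[b0 b1] ab.
have k0 : (0 < k%:R :> R)%R by rewrite ltr0n; lia.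
have ak0 : (0 <= alpha * k%:R)%R by rewrite mulr_ge0 // ltW.
have bk0 : (0 <= beta * k%:R)%R by rewrite mulr_ge0 // ltW.
(* [a] and [b] are the least integers strictly above alpha k and beta k. *)
pose a := (Num.truncn (alpha * k%:R)).+1.
pose b := (Num.truncn (beta * k%:R)).+1.
have ak : a <= k by apply: truncS_leq => //; rewrite gtr_pMl.
have bk : b <= k by apply: truncS_leq => //; rewrite gtr_pMl.
(* k + 2 <= alpha k + beta k < a + b, and strictness between integers gains the last unit. *)
have abk : k + 3 <= a + b.
  rewrite addn3 -(ltr_nat R) natrD; move: ab; rewrite ler_pdivrMr // mulrDl => ab.
  apply: le_lt_trans ab _.
  by apply: ltrD; [case/andP: (truncn_itv ak0)|case/andP: (truncn_itv bk0)].
(* The first summand absorbs the constant of the closeness term; the second gives [2 * k <= n]. *)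
exists (12 * (2 ^ k * k`! * ('C(k, a) * 'C(k, b))) + 2 * k).
move=> n l nN l2 kl.
have meet_refl : reflexive (@inter_ge n k 1).
  by move=> A; rewrite /inter_ge setIid (eqP (valP A)); lia.
have ge_meet c A C : @inter_ge n k c.+1 A C -> inter_ge n k 1 A C.
  by apply: leq_trans.
have [|||c [adm full]] := @exists_full_admissible _ (@inter_ge n k 1)
  (@inter_ge n k a) (@inter_ge n k b) ('C(n, k) %/ l) l _ _ _ meet_refl
  (inter_ge_sym n k 1) (inter_ge_sym n k a) (inter_ge_sym n k b)
  (ge_meet _) (ge_meet _) (inter_ge_deg n k 1) (inter_ge_deg n k a) (inter_ge_deg n k b).
- by lia.
- by rewrite card_kset; apply: inter_degree_small => //; lia.
- by rewrite card_kset leq_divM.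
exists (fun i => [set val A | A in cclass _ _ c i]); split.
- move=> i; split; first by rewrite card_imset ?full //; exact: val_inj.
    by move=> _ /imsetP[A _ ->]; exact/eqP/(valP A).
  move=> _ _ /imsetP[A + ->] /imsetP[B + ->]; rewrite !inE (inj_eq val_inj).
  move=> /eqP cA /eqP cB AB; have := adm_disj _ _ _ _ _ _ _ adm _ _ _ cA cB AB.
  by rewrite /inter_ge -leqNgt leqn0 cards_eq0 setI_eq0.
- move=> i j ij _ /imsetP[A + ->]; rewrite inE => /eqP cA.
  apply/imsetP=> -[B + /val_inj AB]; rewrite inE -AB cA => /eqP[E].
  by rewrite E eqxx in ij.
move=> i j ij [_ [_ [_ [_ [[/imsetP[A1 + ->] /imsetP[B1 + ->] + /imsetP[A2 + ->] /imsetP[B2 + ->]] []]]]]].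
rewrite !inE !(inj_eq val_inj) => /eqP cA1 /eqP cB1 AB1 /eqP cA2 /eqP cB2 AB2.
(* Closeness of two classes yields the intersections of size at least [a] and [b] that [adm_far]
   excludes. *)
move=> /truncS_leq-/(_ ak0) rA /truncS_leq-/(_ bk0) rB.
exact: (adm_far _ _ _ _ _ _ _ adm) ij cA1 cB1 cA2 cB2 AB1 AB2 rA rB.
Qed.
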